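(* Suppose that $\Phi$ is a proper upper semicontinuous real-valued function defined on a (possibly unbounded) closed interval $D\subset\mathbb R$, and let $\widehat\Phi$ be its least concave majorant. Then $\widehat\Phi$ is proper if and only if $\Phi\le l$ on $D$ for some linear (i.e. affine) function $l$. Furthermore, if $\mathrm{conv}(\mathrm{hypo}(\Phi))$ is closed, then the functions $\kappa_L$ and $\kappa_R$ (defined in the context) are well defined, and the following two switching relations hold: for $x\in D$ and $y\in\mathbb R$, (S1) $\widehat\phi_L(x)<y$ if and only if $\kappa_R(y)<x$; (S2) $\widehat\phi_R(x)\le y$ if and only if $\kappa_L(y)\le x$.
   Context: The hypograph of $\Phi$ is $\mathrm{hypo}(\Phi)=\{(x,t): x\in D,\ t\in\mathbb R,\ t\le\Phi(x)\}$, and $\mathrm{conv}$ denotes convex hull. The least concave majorant $\widehat\Phi$ of $\Phi$ is the pointwise infimum of all closed concave functions $g:D\to\mathbb R$ with $g\ge\Phi$ (an infimum over the empty set being $+\infty$); a concave function is closed if it equals its closure, the pointwise infimum of all affine functions lying above it. A function such as $\Phi$ or $\widehat\Phi$ is called proper here if it is $>-\infty$ for at least one point and $<+\infty$ at every point. $\widehat\phi_L$ and $\widehat\phi_R$ denote the left and right derivatives of $\widehat\Phi$, where $\widehat\Phi$ is regarded as a concave function on $\mathbb R$ equal to $-\infty$ outside $D$ (so $\widehat\phi_L(x)=+\infty$ if $x=\min D$ and $\widehat\phi_R(x)=-\infty$ if $x=\max D$). For $y\in\mathbb R$ put $\Phi_y(x)=\Phi(x)-yx$, $x\in D$. The argmax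 functions are $$\kappa_L(y)=\inf\{x\in D:\ \Phi_y(x)=\sup_{z\in D}\Phi_y(z)\},\qquad \kappa_R(y)=\sup\{x\in D:\ \Phi_y(x)=\sup_{z\in D}\Phi_y(z)\}.$$
   Formalization: For unbounded D the argmax set can be empty (D=R, Φ(x)=x, y=0), so S1, S2 are stated for those y where it is nonempty; κ_L, κ_R are shown well defined for all y if D is bounded, and in general exactly when Φ̂ is proper and φ̂_R(x)≤y≤φ̂_L(x) for some x in D. *)

(* Defs.v *)
From HB Require Import structures.
From mathcomp Require Import all_boot all_order all_algebra.
From mathcomp Require Import all_classical all_reals all_analysis.

Set Implicit Arguments.
Unset Strict Implicit.
Unset Printing Implicit Defensive.

Import Order.TTheory GRing.Theory Num.Theory.
Import numFieldNormedType.Exports.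

Local Open Scope classical_set_scope.
Local Open Scope ring_scope.

(* A function on D is a function on R of which only the values on D matter. *)
Section Majorant.
Context {R : realType}.
Implicit Types (D : set R) (Phi g l : R -> R) (f : R -> \bar R) (x y : R).

(* Semicontinuity is relative to D: [subspace D] induces the usual topology on
   D, and the points outside D are isolated in it. *)
Definition usc_on D Phi : Prop :=
  lower_semicontinuous (fun x : subspace D => (- Phi x)%:E).

Definition proper_on D f : Prop :=
  (exists2 x, D x & (-oo < f x)%E) /\ (forall x, D x -> (f x < +oo)%E).

Definition hypo D Phi : set (R^o * R^o) :=
  [set p | D p.1 /\ p.2 <= Phi p.1].

Definition conv_hull (A : set (R^o * R^o)) : set (R^o * R^o) :=
  smallest (@convex_set R (R^o * R^o)%type) A.

Definition affine l : Prop := exists a b : R, forall x, l x = a * x + b.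

Definition concave_on D g : Prop := @convex_function R R^o D (fun x => - g x).

Definition closure_on D g x : \bar R :=
  ereal_inf [set (l x)%:E |
    l in [set l | affine l /\ forall z, D z -> g z <= l z]].

Definition closed_concave_on D g : Prop :=
  concave_on D g /\ forall x, D x -> (g x)%:E = closure_on D g x.

(* Equal to -oo outside D, +oo on D when Phi has no closed concave majorant
   ([ereal_inf set0 = +oo]). *)
Definition lcmaj D Phi x : \bar R :=
  if x \in D then
    ereal_inf [set (g x)%:E |
      g in [set g | closed_concave_on D g /\ forall z, D z -> Phi z <= g z]]
  else -oo%E.

(* Where f x is finite, the quotient is +oo (resp. -oo) if f (x + h) = -oo and
   h < 0 (resp. h > 0): this gives the values at the end points of D. *)
Definition diff_quot f x (h : R) : \bar R :=
  ((f (x + h)%R - f x) * (h^-1)%:E)%E.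

Definition left_deriv f x : \bar R := lim (diff_quot f x h @[h --> (0 : R)^'-]).

Definition right_deriv f x : \bar R := lim (diff_quot f x h @[h --> (0 : R)^'+]).

Definition tilt Phi y x : R := Phi x - y * x.

Definition argmax D Phi y : set R :=
  [set x | D x /\
    (tilt Phi y x)%:E = ereal_sup [set (tilt Phi y z)%:E | z in D]].

Definition kappaL D Phi y : \bar R := ereal_inf (EFin @` argmax D Phi y).

Definition kappaR D Phi y : \bar R := ereal_sup (EFin @` argmax D Phi y).

(* An infimum or supremum over an empty argmax set has no meaning here; over a
   nonempty one it may be infinite when D is unbounded. *)
Definition kappa_defined D Phi y : Prop := argmax D Phi y !=set0.

End Majorant.

(* Main.v *)
Require Import Defs.
From HB Require Import structures.
From mathcomp Require Import all_boot all_order all_algebra.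
From mathcomp Require Import all_classical all_reals all_analysis.
From mathcomp Require Import ring lra.

Import Order.TTheory GRing.Theory Num.Theory.
Import numFieldNormedType.Exports.

Local Open Scope classical_set_scope.
Local Open Scope ring_scope.

(** The least concave majorant [lcmaj D Phi] is, on [D], the infimum of the
    affine functions that dominate [Phi] there ([lcmaj_affE]): a closed concave
    function is the infimum of the affine functions above it, and an affine
    function is closed concave. The equivalence between properness and the
    existence of an affine majorant follows at once.

    Assume now that the majorant is proper and let [f] be its real-valued version
    on [D]. Everything else rests on comparing the tilted functions
    [tilt f y x = f x - y * x].

    On the side of the derivatives, [f] is concave, so its difference quotients
    are monotone and the one-sided derivatives are an infimum and a supremum of
    quotients. Hence the left derivative at [x] is at least [y] iff the tilted [f] is
    at [x] at least what it is anywhere in [D] to the left, and the right derivative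
    is at most [y] iff the same holds to the right ([left_deriv_geP],
    [right_deriv_leP]); the infinite values at the end points of [D] fit this
    pattern.

    On the side of the argmax, a maximiser of the tilted [Phi] also maximises the
    tilted [f], because the horizontal tangent to the tilted [Phi] is an affine
    majorant ([lcmaj_argmax]). Conversely, if [x] maximises the tilted [f], there
    are maximisers of the tilted [Phi] on both sides of [x], in the wide sense
    ([argmax_around]). This is where closedness of the convex hull [C] of the
    hypograph enters: a point [(x, s)] with [Phi x < s] outside [C] lies on an
    affine majorant of [Phi] ([majorant_above_hull]), so that [(x, f x)] must
    belong to [C] when [C] is closed ([conv_hull_lcmaj]); and a point of [C] lying
    on an affine majorant can only be a convex combination of contact points
    between [Phi] and this majorant ([hull_contact]).

    The switching relations combine both sides with the concavity of [f]. As
    [kappaL] and [kappaR] are an infimum and a supremum which are not known to be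
    attained, one also needs that points where [f] does not touch the tangent are
    at a positive distance from the argmax ([argmax_far]); this holds because an
    affine majorant strictly below the tangent at [x] can cross it only at some
    distance from [x]. *)

(** * The least concave majorant as an infimum of affine functions *)

Definition affine_majorant {R : realType} (D : set R) (Phi l : R -> R) : Prop :=
  affine l /\ forall z, D z -> Phi z <= l z.

Lemma affine_line {R : realType} (a b : R) : affine (fun x => a * x + b).
Proof. by exists a, b. Qed.

Lemma affine_chord {R : realType} (l : R -> R) (u x z : R) : affine l ->
  (z - x) * l u + (x - u) * l z = (z - u) * l x.
Proof. by move=> [a [b lE]]; rewrite !lE; ring. Qed.

Lemma affine_closed_concave {R : realType} (D : set R) (l : R -> R) :
  affine l -> closed_concave_on D l.
Proof.
move=> la; split.
  move=> t x y _ _; case: la => a [b lE].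
  rewrite !convRE !lE /conv /=.
  rewrite /unstable.onem /GRing.scale /=; lra.
move=> x Dx; apply/eqP; rewrite eq_le; apply/andP; split.
  by apply: le_ereal_inf_tmp => _ [l' [_ ll'] <-]; rewrite lee_fin ll'.
by apply: ereal_inf_lbound; exists l.
Qed.

(** Replacing each closed concave majorant by the affine functions above it does
    not change the infimum. *)
Lemma lcmaj_affE {R : realType} (D : set R) (Phi : R -> R) (x : R) : D x ->
  lcmaj D Phi x = ereal_inf [set (l x)%:E | l in affine_majorant D Phi].
Proof.
move=> Dx; rewrite /lcmaj mem_set//; apply/eqP; rewrite eq_le; apply/andP; split.
  apply: ereal_inf_le_tmp => _ [l [la ll] <-]; exists l => //.
  by split=> //; exact: affine_closed_concave.
apply: le_ereal_inf_tmp => _ [g [[_ gcl] Phig] <-].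
rewrite gcl//; apply: ereal_inf_le_tmp => _ [l [la gl] <-]; exists l => //.
by split=> // z Dz; exact: le_trans (Phig z Dz) (gl z Dz).
Qed.

Lemma lcmaj_outside {R : realType} (D : set R) (Phi : R -> R) (x : R) :
  ~ D x -> lcmaj D Phi x = -oo%E.
Proof. by move=> nDx; rewrite /lcmaj memNset. Qed.

Lemma lcmaj_ge {R : realType} (D : set R) (Phi : R -> R) (x : R) :
  D x -> ((Phi x)%:E <= lcmaj D Phi x)%E.
Proof.
move=> Dx; rewrite lcmaj_affE//; apply: le_ereal_inf_tmp => _ [l [_ Pl] <-].
by rewrite lee_fin Pl.
Qed.

Lemma lcmaj_le {R : realType} (D : set R) (Phi l : R -> R) (x : R) :
  affine_majorant D Phi l -> D x -> (lcmaj D Phi x <= (l x)%:E)%E.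
Proof. by move=> lP Dx; rewrite lcmaj_affE//; apply: ereal_inf_lbound; exists l. Qed.

Lemma lcmaj_properP {R : realType} (D : set R) (Phi : R -> R) : D !=set0 ->
  proper_on D (lcmaj D Phi) <-> affine_majorant D Phi !=set0.
Proof.
move=> [x0 Dx0]; split.
  move=> [_ /(_ _ Dx0)]; rewrite lcmaj_affE//.
  by move=> /ereal_inf_lt [_ [l lP _] _]; exists l.
move=> [l lP]; split.
  by exists x0 => //; apply: lt_le_trans (lcmaj_ge _ Phi _ Dx0); rewrite ltNyr.
by move=> x Dx; apply: le_lt_trans (lcmaj_le _ _ _ _ lP Dx) _; rewrite ltry.
Qed.

Lemma lcmaj_fin {R : realType} (D : set R) (Phi : R -> R) (x : R) :
  proper_on D (lcmaj D Phi) -> D x ->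
  lcmaj D Phi x = (fine (lcmaj D Phi x))%:E.
Proof.
move=> [_ Py] Dx; rewrite fineK// fin_real// Py// andbT.
by apply: lt_le_trans (lcmaj_ge _ Phi _ Dx); rewrite ltNyr.
Qed.

(** The three-point form of concavity, cleared of denominators: the chord from
    [u] to [z] passes below the graph at [x]. *)
Definition concave_chord {R : realType} (D : set R) (f : R -> R) : Prop :=
  forall u x z, D u -> D z -> u <= x -> x <= z ->
    (z - x) * f u + (x - u) * f z <= (z - u) * f x.

Section finite_majorant.
Context {R : realType} (D : set R) (Phi : R -> R).
Hypothesis D_itv : is_interval D.
Hypothesis P : proper_on D (lcmaj D Phi).
Let f x := fine (lcmaj D Phi x).

Lemma fine_lcmaj_le (l : R -> R) (x : R) :
  affine_majorant D Phi l -> D x -> f x <= l x.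
Proof.
by move=> lP Dx; rewrite -lee_fin -lcmaj_fin//; exact: lcmaj_le.
Qed.

Lemma fine_lcmaj_ge (x : R) : D x -> Phi x <= f x.
Proof. by move=> Dx; rewrite -lee_fin -lcmaj_fin//; exact: lcmaj_ge. Qed.

(** The form in which the infimum is used: a value strictly above the majorant is
    already beaten by one affine function. *)
Lemma fine_lcmaj_lt (x s : R) : D x -> f x < s ->
  exists2 l, affine_majorant D Phi l & l x < s.
Proof.
move=> Dx; rewrite -lte_fin -lcmaj_fin// lcmaj_affE//.
by move=> /ereal_inf_lt [_ [l lP <-]]; rewrite lte_fin => ?; exists l.
Qed.

(** If the chord passed strictly above [x], so would an affine majorant pass
    strictly below the chord at [x]; but it is above both ends of the chord. *)
Lemma fine_lcmaj_concave : concave_chord D f.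
Proof.
move=> u x z Du Dz ux xz.
have Dx : D x by apply: (D_itv u z) => //; rewrite ux xz.
rewrite leNgt; apply/negP => lt_chord.
have uz : u < z.
  rewrite lt_neqAle (le_trans ux xz) andbT; apply/eqP => uz.
  have xu : x = u by lra.
  by move: lt_chord; rewrite -uz xu !subrr !mul0r addr0 ltxx.
have [l lP lx] : exists2 l, affine_majorant D Phi l &
    l x < ((z - x) * f u + (x - u) * f z) / (z - u).
  by apply: fine_lcmaj_lt => //; rewrite ltr_pdivlMr ?subr_gt0// mulrC.
move: lx; rewrite ltr_pdivlMr ?subr_gt0// [l x * _]mulrC.
rewrite -(affine_chord l u x z lP.1).
apply/negP; rewrite -leNgt.
by apply: lerD; rewrite ler_wpM2l ?subr_ge0 ?fine_lcmaj_le.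
Qed.

End finite_majorant.

(** * One-sided derivatives of a concave function *)

Section one_sided_derivatives.
Context {R : realType} (D : set R) (F : R -> \bar R) (f : R -> R).
Hypothesis D_itv : is_interval D.
Hypothesis F_in : forall x, D x -> F x = (f x)%:E.
Hypothesis F_out : forall x, ~ D x -> F x = -oo%E.
Hypothesis f_concave : concave_chord D f.

(** Outside [D] the right quotient is [-oo], so it constrains nothing. *)
Lemma diff_quot_leP (x y h : R) : D x -> 0 < h ->
  (diff_quot F x h <= y%:E)%E <->
  (D (x + h) -> tilt f y (x + h) <= tilt f y x).
Proof.
move=> Dx h0; rewrite /diff_quot /tilt (F_in _ Dx).
have [Dxh|nDxh] := pselect (D (x + h)).
  rewrite (F_in _ Dxh) -EFinB -EFinM lee_fin ler_pdivrMr//.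
  by split=> [|/(_ Dxh)]; lra.
by rewrite (F_out _ nDxh) addNye gt0_mulNye ?lte_fin ?invr_gt0// leNye.
Qed.

(** Outside [D] the left quotient is [-oo] divided by a negative number, that is
    [+oo], so it constrains nothing either. *)
Lemma diff_quot_geP (x y h : R) : D x -> 0 < h ->
  (y%:E <= diff_quot F x (- h))%E <->
  (D (x - h) -> tilt f y (x - h) <= tilt f y x).
Proof.
move=> Dx h0; rewrite /diff_quot /tilt (F_in _ Dx).
have [Dxh|nDxh] := pselect (D (x - h)).
  rewrite (F_in _ Dxh) -EFinB -EFinM lee_fin invrN mulrN -mulNr ler_pdivlMr//.
  by split=> [|/(_ Dxh)]; lra.
rewrite (F_out _ nDxh) addNye lt0_mulNye ?lte_fin ?invr_lt0 ?oppr_lt0//.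
by rewrite leey.
Qed.

Lemma diff_quot_right_nincr (x : R) : D x ->
  {in `]0, +oo[ &, nonincreasing_fun (diff_quot F x)}.
Proof.
move=> Dx h k; rewrite !in_itv/= !andbT => h0 k0 hk; rewrite /diff_quot (F_in _ Dx).
have [Dk|nDk] := pselect (D (x + k)); last first.
  by rewrite (F_out _ nDk) addNye gt0_mulNye ?lte_fin ?invr_gt0// leNye.
have Dh : D (x + h) by apply: (D_itv x (x + k)) => //; lra.
rewrite (F_in _ Dk) (F_in _ Dh) -!EFinB -!EFinM lee_fin.
rewrite ler_pdivrMr// mulrAC ler_pdivlMr//.
have := f_concave x (x + h) (x + k) Dx Dk.
rewrite lerDl lerD2l => /(_ (ltW h0) hk); lra.
Qed.

Lemma diff_quot_left_ndecr (x : R) : D x ->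
  {in `]0, +oo[ &, nondecreasing_fun (fun h => diff_quot F x (- h))}.
Proof.
move=> Dx h k; rewrite !in_itv/= !andbT => h0 k0 hk; rewrite /diff_quot (F_in _ Dx).
have [Dk|nDk] := pselect (D (x - k)); last first.
  rewrite (F_out _ nDk) addNye [leRHS]lt0_mulNye ?leey//.
  by rewrite lte_fin ?invr_lt0 ?oppr_lt0.
have Dh : D (x - h) by apply: (D_itv (x - k) x) => //; lra.
rewrite (F_in _ Dk) (F_in _ Dh) -!EFinB -!EFinM lee_fin.
rewrite !invrN !mulrN -!mulNr ler_pdivrMr// mulrAC ler_pdivlMr//.
have := f_concave (x - k) (x - h) x Dk Dx.
rewrite lerD2l lerN2 gerDl oppr_le0 => /(_ hk (ltW h0)); lra.
Qed.

(** By monotonicity the limit is the supremum of the quotients, and a supremum is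
    at most [y] iff each quotient is. *)
Lemma right_deriv_leP (x y : R) : D x ->
  (right_deriv F x <= y%:E)%E <->
  (forall z, D z -> x < z -> tilt f y z <= tilt f y x).
Proof.
move=> Dx.
have -> : right_deriv F x = ereal_sup (diff_quot F x @` `]0, +oo[).
  apply/cvg_lim => //; apply: nonincreasing_at_right_cvge => //.
  exact: diff_quot_right_nincr.
split=> [supy z Dz xz|mono].
  have h0 : 0 < z - x by rewrite subr_gt0.
  have /(diff_quot_leP _ y _ Dx h0) : (diff_quot F x (z - x) <= y%:E)%E.
    apply: le_trans supy; apply: ereal_sup_ubound; exists (z - x) => //=.
    by rewrite in_itv/= h0.
  by rewrite addrC subrK; exact.
apply: ge_ereal_sup => _ [h /= + <-]; rewrite in_itv/= andbT => h0.
by apply/diff_quot_leP => // Dh; apply: mono; rewrite // ltrDl.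
Qed.

Lemma left_deriv_geP (x y : R) : D x ->
  (y%:E <= left_deriv F x)%E <->
  (forall u, D u -> u < x -> tilt f y u <= tilt f y x).
Proof.
move=> Dx.
have -> : left_deriv F x =
    ereal_inf ((fun h => diff_quot F x (- h)) @` `]0, +oo[).
  have -> : left_deriv F x = lim (diff_quot F x (- h) @[h --> (0 : R)^'+]).
    by rewrite /left_deriv -[in LHS]oppr0 at_leftN.
  apply/cvg_lim => //.
  apply: (@nondecreasing_at_right_cvge _ (fun h => diff_quot F x (- h))) => //.
  exact: diff_quot_left_ndecr.
split=> [yinf u Du ux|mono].
  have h0 : 0 < x - u by rewrite subr_gt0.
  have /(diff_quot_geP _ y _ Dx h0) : (y%:E <= diff_quot F x (- (x - u)))%E.
    apply: le_trans yinf _; apply: ereal_inf_lbound; exists (x - u) => //=.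
    by rewrite in_itv/= h0.
  by rewrite subKr; exact.
apply: le_ereal_inf_tmp => _ [h /= + <-]; rewrite in_itv/= andbT => h0.
by apply/diff_quot_geP => // Dh; apply: mono; rewrite // gtrDl oppr_lt0.
Qed.

End one_sided_derivatives.

(** * Upper semicontinuity *)

Section semicontinuity.
Context {R : realType} (D : set R) (Phi : R -> R).
Hypothesis Phi_usc : usc_on D Phi.

Lemma usc_on_near (x s : R) : D x -> Phi x < s ->
  \forall z \near x, D z -> Phi z < s.
Proof.
move=> Dx xs; have : ((- s)%:E < (- Phi x)%:E)%E by rewrite lte_fin ltrN2.
move=> /(Phi_usc (x : subspace D)) [V].
rewrite /nbhs/= -nbhs_subspace_in// => xV Vs.
by apply: filterS xV => z /Vs; rewrite lte_fin ltrN2.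
Qed.

Lemma usc_on_tilt_near (y x s : R) : D x -> tilt Phi y x < s ->
  \forall z \near x, D z -> tilt Phi y z < s.
Proof.
move=> Dx; rewrite /tilt => xs; pose e := (s - (Phi x - y * x)) / 2.
have e0 : 0 < e by rewrite divr_gt0// subr_gt0.
have Pe : Phi x < Phi x + e by rewrite ltrDl.
have /cvgrPdist_lt/(_ _ e0) ye : y * z @[z --> x] --> y * x.
  by apply: cvgM; [exact: cvg_cst | exact: cvg_id].
near=> z => Dz.
have : Phi z < Phi x + e by apply: (near (usc_on_near _ _ Dx Pe) z).
have : `|y * x - y * z| < e by near: z.
rewrite ltr_norml /e => /andP[_]; lra.
Unshelve. all: by end_near. Qed.

(** Without a maximum, the sets of points of [D] where the tilted function exceeds
    its value at a given point form a proper filter base. Near each point of [D] the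
    function stays below all values taken far enough in this filter; by
    compactness it does so on the whole of [D], hence below some value of its
    own at the very point where it is taken. *)
Lemma usc_attains_max (y : R) : D !=set0 -> compact D ->
  exists2 a, D a & forall z, D z -> tilt Phi y z <= tilt Phi y a.
Proof.
move=> D0 /compact_near_coveringP cD; apply: contrapT => nomax.
have next a : D a -> exists2 w, D w & tilt Phi y a < tilt Phi y w.
  move=> Da; apply: contrapT => nw; apply: nomax; exists a => // z Dz.
  by rewrite leNgt; apply/negP => az; apply: nw; exists z.
pose above a := [set w | D w /\ tilt Phi y a < tilt Phi y w].
have FF : Filter (filter_from D above).
  apply: filter_from_filter => // a b Da Db.
  have [ab|/ltW ba] := leP (tilt Phi y a) (tilt Phi y b).
    by exists b => // w [Dw bw]; split; split => //; exact: le_lt_trans bw.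
  by exists a => // w [Dw bw]; split; split => //; exact: le_lt_trans bw.
have PF : ProperFilter (filter_from D above).
  apply: filter_from_proper => a /next[w Dw aw]; by exists w.
have cover : \forall w \near filter_from D above,
    D `<=` (fun x => D x -> tilt Phi y x < tilt Phi y w).
  apply: cD => a /[dup] Da /next[b Db ab].
  have near_a := usc_on_tilt_near _ _ _ Da ab.
  exists ([set z | D z -> tilt Phi y z < tilt Phi y b], above b) => /=.
    by split => //; exists b.
  move=> [z w] /= [zb [_ bw]] Dz.
  exact: lt_trans (zb Dz) bw.
have inD : filter_from D above D by case: D0 => a Da; exists a => // w [].
have [w [Dw /(_ _ Dw Dw)]] := @filter_ex _ _ PF _ (filterI inD cover).
by rewrite ltxx.
Qed.

End semicontinuity.

Lemma bounded_closed_compactR {R : realType} (D : set R) :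
  bounded_set D -> closed D -> compact D.
Proof.
move=> [M [_ DM]] cD; apply: (subclosed_compact cD (@segment_compact _ (- (M + 1)) (M + 1))).
move=> x Dx /=; have := DM (M + 1); rewrite ltrDl ltr01 => /(_ isT x Dx).
by rewrite in_itv/= ler_norml.
Qed.

(** * The convex hull of the hypograph *)

Lemma conv_hull_hypo {R : realType} (D : set R) (Phi : R -> R) (x t : R) :
  D x -> t <= Phi x -> conv_hull (hypo D Phi) (x, t).
Proof. by move=> Dx tx; apply: sub_gen_smallest. Qed.

Lemma conv_hull_conv {R : realType} (A : set (R^o * R^o)) (u a v b t : R) :
  0 <= t -> t <= 1 -> conv_hull A (u, a) -> conv_hull A (v, b) ->
  conv_hull A (t * u + (1 - t) * v, t * a + (1 - t) * b).
Proof.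
move=> t0 t1 Ap Aq K [Kc AK].
have /set_mem := Kc _ _ (Itv01 t0 t1) (mem_set (Ap K (conj Kc AK))) (mem_set (Aq K (conj Kc AK))).
by [].
Qed.

Section hull.
Context {R : realType} (D : set R) (Phi : R -> R).
Hypothesis D_itv : is_interval D.
Hypothesis Phi_usc : usc_on D Phi.
Let C := conv_hull (hypo D Phi).

(** A chord passing strictly above [(x, s)] would put [(x, s)] in the hull, between
    the graph of [Phi] and the chord. *)
Lemma hull_chord (u x v s : R) : D u -> D v -> u < x -> x < v ->
  D x -> Phi x <= s -> ~ C (x, s) ->
  (v - x) * Phi u + (x - u) * Phi v <= (v - u) * s.
Proof.
move=> Du Dv ux xv Dx xs nC; rewrite leNgt; apply/negP => lt_s; apply: nC.
have vu : 0 < v - u by lra.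
pose t := (v - x) / (v - u).
have t1E : 1 - t = (x - u) / (v - u) by rewrite /t; field; lra.
have t0 : 0 <= t by rewrite divr_ge0//; lra.
have t1 : t <= 1 by rewrite -subr_ge0 t1E divr_ge0//; lra.
(* the height of the chord at x *)
pose s' := t * Phi u + (1 - t) * Phi v.
have Cs' : C (x, s').
  have -> : x = t * u + (1 - t) * v by rewrite t1E /t; field; lra.
  by apply: conv_hull_conv => //; exact: conv_hull_hypo.
have ss' : s < s'.
  rewrite /s' t1E /t.
  have -> : (v - x) / (v - u) * Phi u + (x - u) / (v - u) * Phi v =
    ((v - x) * Phi u + (x - u) * Phi v) / (v - u) by ring.
  by rewrite ltr_pdivlMr// mulrC.
have CPx : C (x, Phi x) by exact: conv_hull_hypo.
have s'x : 0 < s' - Phi x by lra.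
pose r := (s' - s) / (s' - Phi x).
have r1E : 1 - r = (s - Phi x) / (s' - Phi x) by rewrite /r; field; lra.
have -> : (x, s) = (r * x + (1 - r) * x, r * Phi x + (1 - r) * s').
  by congr pair; rewrite r1E /r; field; lra.
apply: conv_hull_conv => //; first by rewrite divr_ge0//; lra.
by rewrite -subr_ge0 r1E divr_ge0//; lra.
Qed.

(** By [hull_chord], every slope from [(x, s)] to the graph on the right of [x] is
    at most every slope on the left; the supremum of the former separates them. *)
Lemma majorant_through_interior (u0 x v0 s : R) :
  D u0 -> D v0 -> u0 < x -> x < v0 ->
  Phi x <= s -> ~ C (x, s) -> exists2 l, affine_majorant D Phi l & l x = s.
Proof.
move=> Du0 Dv0 u0x xv0 xs nC.
have Dx : D x by apply: (D_itv u0 v0) => //; rewrite !ltW.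
pose S := [set (Phi v - s) / (v - x) | v in [set v | D v /\ x < v]].
have Sub u : D u -> u < x -> ubound S ((s - Phi u) / (x - u)).
  move=> Du ux _ [v [Dv xv] <-].
  rewrite ler_pdivrMr ?subr_gt0// mulrAC ler_pdivlMr ?subr_gt0//.
  have := hull_chord _ _ _ _ Du Dv ux xv Dx xs nC; lra.
have S0 : S !=set0 by exists ((Phi v0 - s) / (v0 - x)); exists v0.
have Sbd : has_ubound S by exists ((s - Phi u0) / (x - u0)); exact: Sub.
exists (fun z => sup S * z + (s - sup S * x)); last by rewrite addrC subrK.
split; first exact: affine_line.
move=> z Dz; have [zx|xz|->] := ltgtP z x.
- have := ge_sup S0 (Sub _ Dz zx).
  rewrite ler_pdivlMr ?subr_gt0//; lra.
- have : (Phi z - s) / (z - x) <= sup S by apply: ub_le_sup => //; exists z.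
  rewrite ler_pdivrMr ?subr_gt0//; lra.
- by rewrite addrC subrK.
Qed.

(** Near [x] semicontinuity keeps [Phi] below [s]; farther away a steep cone
    overtakes any given affine majorant. At an end point of [D] such a cone is
    affine. *)
Lemma usc_cone_majorant (x s : R) : affine_majorant D Phi !=set0 ->
  D x -> Phi x < s ->
  exists k, forall z, D z -> Phi z <= s + k * `|z - x|.
Proof.
move=> [l [[a [b lE]] lP]] Dx xs.
have /nbhs_ballP[d /= d0 xd] := usc_on_near _ _ Phi_usc _ _ Dx xs.
(* the first term beats the slope of l, the second makes up for l x > s once
   the distance to x has reached d *)
exists (`|a| + `|l x - s| / d) => z Dz.
have [zd|dz] := ltP `|x - z| d.
  have := xd z zd Dz => /ltW /le_trans; apply.
  by rewrite lerDl mulr_ge0// addr_ge0// divr_ge0// ltW.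
apply: le_trans (lP z Dz) _.
have -> : l z = s + (l x - s) + a * (z - x) by rewrite !lE; ring.
rewrite -addrA lerD2l mulrDl addrC; apply: lerD.
  by rewrite -normrM ler_norm.
apply: le_trans (ler_norm _) _; rewrite mulrAC ler_pdivlMr//.
by apply: ler_wpM2l => //; rewrite distrC.
Qed.

(** A separation theorem in the plane. No vertical line is needed since
    [(x, Phi x)] lies below [(x, s)] in the hull. *)
Lemma majorant_above_hull (x s : R) : affine_majorant D Phi !=set0 ->
  D x -> Phi x < s -> ~ C (x, s) ->
  exists2 l, affine_majorant D Phi l & l x = s.
Proof.
move=> maj Dx xs nC.
have [k kP] := usc_cone_majorant _ _ maj Dx xs.
have [[u [Du ux]]|nou] := pselect (exists u, D u /\ u < x); last first.
  exists (fun z => k * z + (s - k * x)); last by rewrite addrC subrK.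
  split=> [|z Dz]; first exact: affine_line.
  have := kP z Dz; rewrite ger0_norm ?subr_ge0; first by lra.
  by rewrite leNgt; apply/negP => zx; apply: nou; exists z.
have [[v [Dv xv]]|nov] := pselect (exists v, D v /\ x < v); last first.
  exists (fun z => - k * z + (s - - k * x)); last by rewrite addrC subrK.
  split=> [|z Dz]; first exact: affine_line.
  have := kP z Dz; rewrite ler0_norm ?subr_le0; first by lra.
  by rewrite leNgt; apply/negP => zx; apply: nov; exists z.
exact: (majorant_through_interior u x v) (ltW xs) nC.
Qed.

(** Otherwise some point slightly below [(x, f x)] would also avoid the closed hull,
    and an affine majorant through it would contradict the minimality of [f]. *)
Lemma conv_hull_lcmaj (x : R) : closed C -> proper_on D (lcmaj D Phi) -> D x ->
  C (x, fine (lcmaj D Phi x)).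
Proof.
move=> clC P Dx; apply: contrapT => nC; set s := fine _ in nC.
have maj : affine_majorant D Phi !=set0 by apply/lcmaj_properP => //; exists x.
have xs : Phi x < s.
  rewrite lt_neqAle fine_lcmaj_ge// andbT; apply/eqP => xs; apply: nC.
  by rewrite -xs; exact: conv_hull_hypo.
have : nbhs ((x, s) : R^o * R^o) (~` C).
  by apply: open_nbhs_nbhs; split => //; exact: closed_openC.
move=> [[A B] /= [/nbhs_singleton xA /nbhs_ballP[e /= e0 se]] ABC].
(* below s, but within the ball of radius e and above Phi x *)
pose r := s - Num.min (e / 2) ((s - Phi x) / 2).
have [r0 re rx] : [/\ r < s, s - e < r & Phi x < r].
  rewrite /r; have [?|?] := leP (e / 2) ((s - Phi x) / 2); split; lra.
have nCr : ~ C (x, r) by apply: (ABC (x, r)); split => //; apply: se; rewrite /ball/= ger0_norm; lra.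
have [l lP lx] := majorant_above_hull _ _ maj Dx rx nCr.
have := fine_lcmaj_le D Phi P l x lP Dx; rewrite lx -/s; lra.
Qed.

(** The points below [l] which, when on [l], have contact points on both sides,
    form a convex set: a proper convex combination lies on [l] only if both points
    do. As this set contains the hypograph, it contains the hull. *)
Lemma hull_contact (l : R -> R) (x : R) : affine_majorant D Phi l ->
  C (x, l x) ->
  (exists a, [/\ D a, a <= x & Phi a = l a]) /\
  (exists b, [/\ D b, x <= b & Phi b = l b]).
Proof.
move=> [la lP].
pose contact u := (exists a, [/\ D a, a <= u & Phi a = l a]) /\
  (exists b, [/\ D b, u <= b & Phi b = l b]).
pose K : set (R^o * R^o) := [set p | p.2 <= l p.1 /\ (p.2 = l p.1 -> contact p.1)].
suff CK : C `<=` K by move=> /CK [_ /(_ erefl)].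
apply: smallest_sub; last first.
  move=> [u t] [/= Du tu]; split=> /= [|tl]; first exact: le_trans tu (lP u Du).
  have Pu : Phi u = l u by apply/eqP; rewrite eq_le lP//= -tl.
  by split; exists u.
apply/convex_setW => -[u a] [v b] /set_mem[/= ul uc] /set_mem[/= vl vc] t.
set r := t%:num => r0 r1; apply/mem_set; rewrite /K /conv/= -/r /unstable.onem /GRing.scale/=.
have lD : l (r * u + (1 - r) * v) = r * l u + (1 - r) * l v.
  by case: la => c [d lE]; rewrite !lE; ring.
have ra : r * a <= r * l u by rewrite ler_pM2l.
have rb : (1 - r) * b <= (1 - r) * l v by rewrite ler_pM2l// subr_gt0.
split=> [|eq_l]; first by rewrite lD lerD.
have [al bl] : a = l u /\ b = l v.
  split.
    by apply: (@mulfI _ r); [rewrite gt_eqF|lra].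
  by apply: (@mulfI _ (1 - r)); [rewrite gt_eqF// subr_gt0|lra].
have [[a1 [Da1 a1u Pa1]] [b1 [Db1 ub1 Pb1]]] := uc al.
have [[a2 [Da2 a2v Pa2]] [b2 [Db2 vb2 Pb2]]] := vc bl.
split.
- have [uv|vu] := leP u v.
    by exists a1; split=> //; apply: le_trans a1u _; nra.
  by exists a2; split=> //; apply: le_trans a2v _; nra.
- have [uv|vu] := leP u v.
    by exists b2; split=> //; apply: le_trans vb2; nra.
  by exists b1; split=> //; apply: le_trans ub1; nra.
Qed.

End hull.

(** * Argmax and switching relations *)

Section switching.
Context {R : realType} (D : set R) (Phi : R -> R) (y : R).
Hypothesis D_itv : is_interval D.
Hypothesis Phi_usc : usc_on D Phi.
Let F := lcmaj D Phi.
Let f x := fine (F x).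

Lemma argmaxP (a : R) : argmax D Phi y a <->
  D a /\ forall z, D z -> tilt Phi y z <= tilt Phi y a.
Proof.
split=> [[Da maxa]|[Da maxa]]; split=> //.
  by move=> z Dz; rewrite -lee_fin maxa; apply: ereal_sup_ubound; exists z.
apply/eqP; rewrite eq_le; apply/andP; split.
  by apply: ereal_sup_ubound; exists a.
by apply: ge_ereal_sup => _ [z Dz <-]; rewrite lee_fin maxa.
Qed.

Lemma affine_majorant_tilt (m : R) : (forall z, D z -> tilt Phi y z <= m) ->
  affine_majorant D Phi (fun z => y * z + m).
Proof.
move=> mP; split=> [|z Dz]; first exact: affine_line.
by have := mP z Dz; rewrite /tilt; lra.
Qed.

Lemma argmax_proper (a : R) : argmax D Phi y a -> proper_on D F.
Proof.
move=> /argmaxP[Da maxa]; apply/lcmaj_properP; first by exists a.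
by eexists; exact: affine_majorant_tilt maxa.
Qed.

(** The line of slope [y] touching [Phi] at [a] dominates [Phi], hence [f]. *)
Lemma lcmaj_argmax (a z : R) : argmax D Phi y a -> D z ->
  tilt f y z <= tilt f y a.
Proof.
move=> aM Dz; have P := argmax_proper _ aM.
have /argmaxP[Da maxa] := aM.
have := fine_lcmaj_le _ _ P _ _ (affine_majorant_tilt _ maxa) Dz.
have := fine_lcmaj_ge _ _ P _ Da.
by rewrite /tilt -/F /f; lra.
Qed.

(** The line of slope [y] through [(x, f x)] is a majorant of [Phi], and the
    points where it touches [Phi] maximise the tilted [Phi]. *)
Lemma argmax_around (x : R) : closed (conv_hull (hypo D Phi)) ->
  proper_on D F -> D x -> (forall z, D z -> tilt f y z <= tilt f y x) ->
  (exists2 a, argmax D Phi y a & a <= x) /\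
  (exists2 b, argmax D Phi y b & x <= b).
Proof.
move=> clC P Dx maxx.
have maxPhi z : D z -> tilt Phi y z <= tilt f y x.
  move=> Dz; apply: le_trans (maxx z Dz).
  by rewrite /tilt lerD2r; exact: fine_lcmaj_ge.
have contactP c : D c -> Phi c = y * c + tilt f y x -> argmax D Phi y c.
  move=> Dc cE; apply/argmaxP; split=> // z Dz.
  by apply: le_trans (maxPhi z Dz) _; rewrite {2}/tilt cE; lra.
have Cx := conv_hull_lcmaj _ _ D_itv Phi_usc _ clC P Dx.
have := hull_contact D Phi _ x (affine_majorant_tilt _ maxPhi).
have -> : y * x + tilt f y x = f x by rewrite /tilt; lra.
move=> /(_ Cx) [[a [Da ax aE]] [b [Db xb bE]]]; split.
  by exists a => //; exact: contactP.
by exists b => //; exact: contactP.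
Qed.

(** Superlevel sets of a tilted concave function are intervals. *)
Lemma concave_tilt_between (g : R -> R) (u x z m : R) : concave_chord D g ->
  D u -> D z -> u <= x -> x <= z -> m <= tilt g y u -> m <= tilt g y z ->
  m <= tilt g y x.
Proof.
move=> gc Du Dz ux xz mu mz.
have := gc u x z Du Dz ux xz.
have [uz|zu] := ltP u z; last by have -> : x = u by lra.
move=> chord; rewrite -(ler_pM2l (_ : 0 < z - u)) ?subr_gt0//.
have : (z - x) * m <= (z - x) * tilt g y u by rewrite ler_wpM2l// subr_ge0.
have : (x - u) * m <= (x - u) * tilt g y z by rewrite ler_wpM2l// subr_ge0.
by move: chord; rewrite /tilt; lra.
Qed.

(** Take an affine majorant [l] with [l x] strictly below the line of slope [y]
    that touches [Phi] at [a]. On the argmax, [l] is above this line, and two lines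
    cannot change order arbitrarily close to [x]. *)
Lemma argmax_far (a x : R) : argmax D Phi y a -> D x ->
  tilt f y x < tilt f y a ->
  exists2 e, 0 < e & forall b, argmax D Phi y b -> e <= `|b - x|.
Proof.
move=> aM Dx lt_xa; have P := argmax_proper _ aM.
have [l [[c [d lE]] lP] lx] : exists2 l, affine_majorant D Phi l &
    l x < y * x + tilt Phi y a.
  apply: fine_lcmaj_lt => //.
  have [Da maxa] := (argmaxP a).1 aM.
  have := fine_lcmaj_le _ _ P _ _ (affine_majorant_tilt _ maxa) Da.
  by move: lt_xa; rewrite /tilt -/F /f; lra.
(* the gap at x divided by the difference of the slopes c and y; the added 1
   covers the case of parallel lines *)
pose e := (y * x + tilt Phi y a - l x) / (`|c - y| + 1).
have c0 : 0 < `|c - y| + 1 by rewrite ltr_wpDl.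
exists e; first by rewrite divr_gt0// subr_gt0.
move=> b bM; rewrite /e ler_pdivrMr//.
have [Db maxb] := (argmaxP b).1 bM.
have [Da _] := (argmaxP a).1 aM.
have := lP b Db; have := maxb a Da; rewrite !lE mulrDr mulr1 -normrM.
have := ler_norm ((b - x) * (c - y)); have := normr_ge0 (b - x).
by rewrite /tilt; lra.
Qed.

Hypothesis P : proper_on D F.

Lemma right_deriv_lcmaj_leP (x : R) : D x ->
  (right_deriv F x <= y%:E)%E <->
  (forall z, D z -> x < z -> tilt f y z <= tilt f y x).
Proof.
apply: (right_deriv_leP _ _ _ D_itv).
- by move=> ? ?; exact: lcmaj_fin.
- by move=> ? ?; exact: lcmaj_outside.
- exact: fine_lcmaj_concave.
Qed.

Lemma left_deriv_lcmaj_geP (x : R) : D x ->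
  (y%:E <= left_deriv F x)%E <->
  (forall u, D u -> u < x -> tilt f y u <= tilt f y x).
Proof.
apply: (left_deriv_geP _ _ _ D_itv).
- by move=> ? ?; exact: lcmaj_fin.
- by move=> ? ?; exact: lcmaj_outside.
- exact: fine_lcmaj_concave.
Qed.

Lemma lcmaj_max_derivP (x : R) : D x ->
  (right_deriv F x <= y%:E)%E /\ (y%:E <= left_deriv F x)%E <->
  (forall z, D z -> tilt f y z <= tilt f y x).
Proof.
move=> Dx; rewrite right_deriv_lcmaj_leP// left_deriv_lcmaj_geP//.
split=> [[maxr maxl] z Dz|maxx]; last by split=> z Dz _; exact: maxx.
by have [zx|xz|->//] := ltgtP z x; [exact: maxl | exact: maxr].
Qed.

Hypothesis clC : closed (conv_hull (hypo D Phi)).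

(** If the tilted [f] is nowhere larger to the left of [x] than at [x], then either some maximiser is to the
    right of [x], or [x] is itself a maximiser for [f] and [argmax_around] gives
    one. Conversely, a maximiser to the right of [x] makes the tilted [f]
    nondecreasing up to [x]; and if all of them are to the left while [x] is at
    most their supremum, then [argmax_far] makes [x] a maximiser for [f]. *)
Lemma left_deriv_kappaRP (x : R) : D x -> argmax D Phi y !=set0 ->
  (y%:E <= left_deriv F x)%E <-> (x%:E <= kappaR D Phi y)%E.
Proof.
move=> Dx [a aM]; have [Da _] := (argmaxP a).1 aM.
rewrite left_deriv_lcmaj_geP//.
have kR b : argmax D Phi y b -> x <= b -> (x%:E <= kappaR D Phi y)%E.
  move=> bM xb; apply: (@le_trans _ _ b%:E); first by rewrite lee_fin.
  by apply: ereal_sup_ubound; exists b.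
split=> [maxl|xk].
  have [xa|ax] := leP x a; first exact: kR xa.
  have [z Dz|_ [b bM xb]] := argmax_around x clC P Dx; last exact: kR xb.
  exact: le_trans (lcmaj_argmax _ _ aM Dz) (maxl a Da ax).
have [[b [bM xb]]|nob] := pselect (exists b, argmax D Phi y b /\ x <= b).
  move=> u Du ux; have [Db _] := (argmaxP b).1 bM.
  apply: (concave_tilt_between f u x b) => //; first exact: fine_lcmaj_concave.
    exact: ltW.
  exact: lcmaj_argmax.
move=> u Du _; apply: le_trans (lcmaj_argmax _ _ aM Du) _.
rewrite leNgt; apply/negP => lt_xa.
have [e e0 far] := argmax_far _ _ aM Dx lt_xa.
have : (kappaR D Phi y <= (x - e)%:E)%E.
  apply: ge_ereal_sup => _ [b bM <-]; rewrite lee_fin.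
  have bx : b < x by rewrite ltNge; apply/negP => xb; apply: nob; exists b.
  by have := far b bM; rewrite ltr0_norm ?subr_lt0//; lra.
by move=> /(le_trans xk); rewrite lee_fin; lra.
Qed.

Lemma right_deriv_kappaLP (x : R) : D x -> argmax D Phi y !=set0 ->
  (right_deriv F x <= y%:E)%E <-> (kappaL D Phi y <= x%:E)%E.
Proof.
move=> Dx [a aM]; have [Da _] := (argmaxP a).1 aM.
rewrite right_deriv_lcmaj_leP//.
have kL b : argmax D Phi y b -> b <= x -> (kappaL D Phi y <= x%:E)%E.
  move=> bM bx; apply: (@le_trans _ _ b%:E); last by rewrite lee_fin.
  by apply: ereal_inf_lbound; exists b.
split=> [maxr|kx].
  have [ax|xa] := leP a x; first exact: kL ax.
  have [z Dz|[b bM bx] _] := argmax_around x clC P Dx; last exact: kL bx.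
  exact: le_trans (lcmaj_argmax _ _ aM Dz) (maxr a Da xa).
have [[b [bM bx]]|nob] := pselect (exists b, argmax D Phi y b /\ b <= x).
  move=> z Dz xz; have [Db _] := (argmaxP b).1 bM.
  apply: (concave_tilt_between f b x z) => //; first exact: fine_lcmaj_concave.
    exact: ltW.
  exact: lcmaj_argmax.
move=> z Dz _; apply: le_trans (lcmaj_argmax _ _ aM Dz) _.
rewrite leNgt; apply/negP => lt_xa.
have [e e0 far] := argmax_far _ _ aM Dx lt_xa.
have : ((x + e)%:E <= kappaL D Phi y)%E.
  apply: le_ereal_inf_tmp => _ [b bM <-]; rewrite lee_fin.
  have xb : x < b by rewrite ltNge; apply/negP => bx; apply: nob; exists b.
  by have := far b bM; rewrite gtr0_norm ?subr_gt0//; lra.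
by move=> /le_trans/(_ kx); rewrite lee_fin; lra.
Qed.

End switching.

Theorem theorem2p1 (R : realType) (D : set R) (Phi : R -> R)
    (D_itv : is_interval D) (D_closed : closed D)
    (Phi_proper : proper_on D (EFin \o Phi)) (Phi_usc : usc_on D Phi) :
  (proper_on D (lcmaj D Phi) <->
     exists2 l : R -> R, affine l & forall x, D x -> Phi x <= l x) /\
  (closed (conv_hull (hypo D Phi)) ->
     [/\ (bounded_set D -> forall y : R, kappa_defined D Phi y),
         (forall y : R, kappa_defined D Phi y <->
            proper_on D (lcmaj D Phi) /\
            exists x : R, [/\ D x,
              (right_deriv (lcmaj D Phi) x <= y%:E)%E &
              (y%:E <= left_deriv (lcmaj D Phi) x)%E])
       & (forall x y : R, D x -> kappa_defined D Phi y ->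
            ((left_deriv (lcmaj D Phi) x < y%:E)%E <->
               (kappaR D Phi y < x%:E)%E) /\
            ((right_deriv (lcmaj D Phi) x <= y%:E)%E <->
               (kappaL D Phi y <= x%:E)%E))]).
Proof.
have D0 : D !=set0 by case: Phi_proper => -[x0 Dx0 _] _; exists x0.
split.
  rewrite lcmaj_properP//; split; first by move=> [l [la lP]]; exists l.
  by move=> [l la lP]; exists l.
move=> clC; split.
- move=> bD y.
  have [a Da maxa] := usc_attains_max _ _ Phi_usc y D0
    (bounded_closed_compactR _ bD D_closed).
  by exists a; apply/argmaxP.
- move=> y; split.
    move=> [a aM]; have P := argmax_proper _ _ _ _ aM.
    have [Da _] := (argmaxP _ _ _ _).1 aM.
    split=> //; exists a.
    have /(lcmaj_max_derivP _ _ _ D_itv P _ Da)[rd ld] := lcmaj_argmax _ _ _ _ ^~ aM.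
    by split.
  move=> [P [x [Dx rd ld]]].
  have := (lcmaj_max_derivP _ _ y D_itv P _ Dx).1 (conj rd ld).
  by move=> /(argmax_around _ _ _ D_itv Phi_usc _ clC P Dx)[[a aM _] _]; exists a.
- move=> x y Dx k0; have [a aM] := k0; have P := argmax_proper _ _ _ _ aM.
  split; last exact: right_deriv_kappaLP.
  have [ldk kld] := left_deriv_kappaRP _ _ _ D_itv Phi_usc P clC _ Dx k0.
  by rewrite !ltNge; split; apply: contraNN.
Qed.
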